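(* Let $\mathbb{C}$ be a modified category of interest. Then the category $\mathbf{XMod}(\mathbb{C})$ of crossed modules in $\mathbb{C}$ and the category $\mathbf{Cat}^{1}(\mathbb{C})$ of cat$^1$-objects in $\mathbb{C}$ are naturally equivalent (i.e. there is an equivalence of categories between them).
   Context: **Modified category of interest.** Let $\mathbb{C}$ be a category of groups with a set of operations $\Omega$ and a set of identities $\mathbb{E}$ (objects are the algebras with operations $\Omega$ satisfying $\mathbb{E}$, morphisms are the maps preserving all operations), where $\mathbb{E}$ includes the group identities. Let $\Omega_i$ be the set of $i$-ary operations in $\Omega$. $\mathbb{C}$ is a modified category of interest if: (a) $\Omega=\Omega_0\cup\Omega_1\cup\Omega_2$; (b) the group operations, written additively $0,-,+$ (the group need not be commutative), are elements of $\Omega_0,\Omega_1,\Omega_2$ respectively; with $\Omega_2'=\Omega_2\setminus\{+\}$ and $\Omega_1'=\Omega_1\setminus\{-\}$, if $\ast\in\Omega_2'$ then $\Omega_2'$ contains $\ast^\circ$ defined by $x\ast^\circ y=y\ast x$; and $\Omega_0=\{0\}$; (c) for each $\ast\in\Omega_2'$, $\mathbb{E}$ includes $x\ast(y+z)=x\ast y+x\ast z$; (d) for each $\omega\in\Omega_1'$ and $\ast\in\Omega_2'$, $\mathbb{E}$ includes $\omega(x+y)=\omega(x)+\omega(y)$ and $\omega(x\ast y)=\omega(x)\ast\omega(y)$; and for every object $C$ and $x_1,x_2,x_3\in C$: (Axiom 1) $x_1+(x_2\ast x_3)=(x_2\ast x_3)+x_1$ for each $\ast\in\Omega_2'$; (Axiom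 2) for each ordered pair $(\ast,\overline{\ast})\in\Omega_2'\times\Omega_2'$ there is a word $W$ such that $(x_1\ast x_2)\overline{\ast}x_3=W(x_1(x_2x_3),x_1(x_3x_2),(x_2x_3)x_1,(x_3x_2)x_1,x_2(x_1x_3),x_2(x_3x_1),(x_1x_3)x_2,(x_3x_1)x_2)$, where each juxtaposition represents an operation in $\Omega_2'$. **Derived actions.** For a split extension $0\to A\to E\xrightarrow{p}B\to 0$ in $\mathbb{C}$ with section $s:B\to E$ (a morphism with $ps=1_B$), the associated derived action of $B$ on $A$ consists of the maps $b\cdot a=s(b)+a-s(b)$ and $b\ast a=s(b)\ast a$ for $a\in A$, $b\in B$, $\ast\in\Omega_2'$ (with $a\ast b$ meaning $b\ast^\circ a$). A derived action of $B$ on $A$ is a set of maps arising in this way from some split extension. **Crossed modules.** A precrossed module in $\mathbb{C}$ is a triple $(C_1,C_0,\partial)$ where $C_0,C_1\in\mathbb{C}$, $C_0$ has a derived action on $C_1$, and $\partial:C_1\to C_0$ is a morphism in $\mathbb{C}$ with $\partial(c_0\cdot c_1)=c_0+\partial(c_1)-c_0$ and $\partial(c_0\ast c_1)=c_0\ast\partial(c_1)$ for all $c_0\in C_0$, $c_1\in C_1$, $\ast\in\Omega_2'$. It is a crossed module if moreover $\partial(c_1)\cdot c_1'=c_1+c_1'-c_1$ and $\partial(c_1)\ast c_1'=c_1\ast c_1'$ for all $c_1,c_1'\in C_1$, $\ast\in\Omega_2'$. A morphism $(C_1,C_0,\partial)\to(C_1',C_0',\partial')$ is a pair $(\mu_1,\mu_0)$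 of $\mathbb{C}$-morphisms $\mu_i:C_i\to C_i'$ with $\mu_0\partial=\partial'\mu_1$, $\mu_1(c_0\cdot c_1)=\mu_0(c_0)\cdot\mu_1(c_1)$ and $\mu_1(c_0\ast c_1)=\mu_0(c_0)\ast\mu_1(c_1)$ for all $c_0,c_1$ and $\ast\in\Omega_2'$. This gives the category $\mathbf{XMod}(\mathbb{C})$ of crossed modules. **Cat$^1$-objects.** A cat$^1$-object in $\mathbb{C}$ is a triple $(C,\omega_0,\omega_1)$, where $C\in\mathbb{C}$ and $\omega_0,\omega_1:C\to C$ are morphisms in $\mathbb{C}$ with $\omega_0\omega_1=\omega_1$, $\omega_1\omega_0=\omega_0$, and $x\ast y=0$, $x+y-x-y=0$ for all $\ast\in\Omega_2'$, $x\in\ker\omega_0$, $y\in\ker\omega_1$. Morphisms of cat$^1$-objects are the $\mathbb{C}$-morphisms compatible with the maps $\omega_0$ and $\omega_1$. This gives the category $\mathbf{Cat}^1(\mathbb{C})$. *)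

(* Defs.v *)
From Stdlib Require Import ProofIrrelevance.

Set Implicit Arguments.
Unset Strict Implicit.
Unset Printing Implicit Defensive.

Declare Scope term_scope.
Delimit Scope term_scope with term.
Declare Scope alg_scope.
Delimit Scope alg_scope with alg.

(** * Categories *)

Record category := Category {
  Obj :> Type;
  Hom : Obj -> Obj -> Type;
  idm : forall a, Hom a a;
  comp : forall a b c, Hom b c -> Hom a b -> Hom a c;
  comp_idl : forall a b (f : Hom a b), comp (idm b) f = f;
  comp_idr : forall a b (f : Hom a b), comp f (idm a) = f;
  compA : forall a b c d (h : Hom c d) (g : Hom b c) (f : Hom a b),
    comp h (comp g f) = comp (comp h g) f
}.

Arguments Hom {C} a b : rename.
Arguments idm {C} a : rename.
Arguments comp {C a b c} g f : rename.

Record functor (C D : category) := Functor {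
  fobj :> C -> D;
  fmap : forall a b : C, Hom a b -> Hom (fobj a) (fobj b);
  fmap_id : forall a : C, fmap (idm a) = idm (fobj a);
  fmap_comp : forall (a b c : C) (g : Hom b c) (f : Hom a b),
    fmap (comp g f) = comp (fmap g) (fmap f)
}.

Arguments fmap {C D} F {a b} f : rename.

Definition functor_id (C : category) : functor C C :=
  @Functor C C (fun a => a) (fun _ _ f => f)
    (fun _ => eq_refl) (fun _ _ _ _ _ => eq_refl).

Definition functor_comp (C D E : category) (G : functor D E) (F : functor C D) :
  functor C E.
Proof.
refine (@Functor C E (fun a => G (F a)) (fun _ _ f => fmap G (fmap F f)) _ _).
- intros a; rewrite fmap_id; apply fmap_id.
- intros a b c g f; rewrite fmap_comp; apply fmap_comp.
Defined.

Record nat_iso (C D : category) (F G : functor C D) := NatIso {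
  iso_to : forall a : C, Hom (F a) (G a);
  iso_from : forall a : C, Hom (G a) (F a);
  iso_toK : forall a : C, comp (iso_from a) (iso_to a) = idm (F a);
  iso_fromK : forall a : C, comp (iso_to a) (iso_from a) = idm (G a);
  iso_natural : forall (a b : C) (f : Hom a b),
    comp (iso_to b) (fmap F f) = comp (fmap G f) (iso_to a)
}.

Record equivalence (C D : category) := Equivalence {
  equiv_fwd : functor C D;
  equiv_bwd : functor D C;
  equiv_unit : nat_iso (functor_id C) (functor_comp equiv_bwd equiv_fwd);
  equiv_counit : nat_iso (functor_comp equiv_fwd equiv_bwd) (functor_id D)
}.

(** * Groups with operations *)

(** The operations are [0], [-], [+], together with [un_op] (the unary
    operations other than [-]) and [bin_op] (the binary operations other than
    [+]); [op] is the assignment of the opposite operation. *)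
Record signature := Signature {
  un_op : Type;
  bin_op : Type;
  op : bin_op -> bin_op
}.

Inductive term (S : signature) (V : Type) : Type :=
| Var (n : V)
| Zero
| Neg (t : term S V)
| Add (t u : term S V)
| Un (w : un_op S) (t : term S V)
| Bin (s : bin_op S) (t u : term S V).

Arguments Var {S V} n.
Arguments Zero {S V}.
Arguments Neg {S V} t.
Arguments Add {S V} t u.
Arguments Un {S V} w t.
Arguments Bin {S V} s t u.
Notation "0" := Zero : term_scope.
Notation "- t" := (Neg t) : term_scope.
Notation "t + u" := (Add t u) : term_scope.
Bind Scope term_scope with term.

Record algebra (S : signature) := Algebra {
  carrier :> Type;
  zero : carrier;
  neg : carrier -> carrier;
  add : carrier -> carrier -> carrier;
  un : un_op S -> carrier -> carrier;
  bin : bin_op S -> carrier -> carrier -> carrier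
}.

Arguments zero {S A} : rename.
Arguments neg {S A} x : rename.
Arguments add {S A} x y : rename.
Arguments un {S A} w x : rename.
Arguments bin {S A} s x y : rename.

Notation "0" := zero : alg_scope.
Notation "- x" := (neg x) : alg_scope.
Notation "x + y" := (add x y) : alg_scope.
Notation "x - y" := (add x (neg y)) : alg_scope.
Local Open Scope alg_scope.

Fixpoint eval (S : signature) (V : Type) (A : algebra S) (v : V -> A)
    (t : term S V) : A :=
  match t with
  | Var x => v x
  | Zero => 0
  | Neg t1 => - eval v t1
  | Add t1 t2 => eval v t1 + eval v t2
  | Un w t1 => un w (eval v t1)
  | Bin s t1 t2 => bin s (eval v t1) (eval v t2)
  end.

Definition identity (S : signature) : Type := (term S nat * term S nat)%type.

Notation "t =id u" := (t%term, u%term) (at level 70, only parsing).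

Definition satisfies (S : signature) (A : algebra S) (e : identity S) : Prop :=
  forall v : nat -> A, eval v (fst e) = eval v (snd e).

Record object (S : signature) (E : identity S -> Prop) := Object {
  object_alg :> algebra S;
  object_sat : forall e, E e -> satisfies object_alg e
}.

Record hom (S : signature) (A B : algebra S) := MkHom {
  hom_fun :> A -> B;
  hom_zero : hom_fun 0 = 0;
  hom_neg : forall x, hom_fun (- x) = - hom_fun x;
  hom_add : forall x y, hom_fun (x + y) = hom_fun x + hom_fun y;
  hom_un : forall w x, hom_fun (un w x) = un w (hom_fun x);
  hom_bin : forall s x y, hom_fun (bin s x y) = bin s (hom_fun x) (hom_fun y)
}.

Definition hom_id (S : signature) (A : algebra S) : hom A A :=
  @MkHom S A A (fun x => x) eq_refl (fun _ => eq_refl) (fun _ _ => eq_refl)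
    (fun _ _ => eq_refl) (fun _ _ _ => eq_refl).

Definition hom_comp (S : signature) (A B C : algebra S)
  (g : hom B C) (f : hom A B) : hom A C.
Proof.
refine (@MkHom S A C (fun x => g (f x)) _ _ _ _ _).
- now rewrite !hom_zero.
- now intros x; rewrite !hom_neg.
- now intros x y; rewrite !hom_add.
- now intros w x; rewrite !hom_un.
- now intros s x y; rewrite !hom_bin.
Defined.

(** * Modified categories of interest *)

(** [A1_23] stands for x1(x2x3), [A23_1] for (x2x3)x1, and so on. *)
Inductive word_arg := A1_23 | A1_32 | A23_1 | A32_1 | A2_13 | A2_31 | A13_2 | A31_2.

(** [o a] and [i a] interpret the outer and the inner juxtaposition in the
    argument [a]. *)
Definition word_arg_val (S : signature) (A : algebra S)
    (o i : word_arg -> bin_op S) (x1 x2 x3 : A) (a : word_arg) : A :=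
  match a with
  | A1_23 => bin (o a) x1 (bin (i a) x2 x3)
  | A1_32 => bin (o a) x1 (bin (i a) x3 x2)
  | A23_1 => bin (o a) (bin (i a) x2 x3) x1
  | A32_1 => bin (o a) (bin (i a) x3 x2) x1
  | A2_13 => bin (o a) x2 (bin (i a) x1 x3)
  | A2_31 => bin (o a) x2 (bin (i a) x3 x1)
  | A13_2 => bin (o a) (bin (i a) x1 x3) x2
  | A31_2 => bin (o a) (bin (i a) x3 x1) x2
  end.

Record modified_category_of_interest (S : signature) (E : identity S -> Prop)
    (x : term S nat := Var 0%nat) (y : term S nat := Var 1%nat)
    (z : term S nat := Var 2%nat) : Prop := {
  mci_addA : E (x + (y + z) =id (x + y) + z);
  mci_add0l : E (0 + x =id x);
  mci_add0r : E (x + 0 =id x);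
  mci_addNl : E (- x + x =id 0);
  mci_addNr : E (x + - x =id 0);
  mci_op : forall (s : bin_op S) (C : object E) (x1 x2 : C),
    bin (op s) x1 x2 = bin s x2 x1;
  mci_distr : forall s : bin_op S,
    E (Bin s x (y + z) =id Bin s x y + Bin s x z);
  mci_un_add : forall w : un_op S, E (Un w (x + y) =id Un w x + Un w y);
  mci_un_bin : forall (w : un_op S) (s : bin_op S),
    E (Un w (Bin s x y) =id Bin s (Un w x) (Un w y));
  mci_axiom1 : forall (s : bin_op S) (C : object E) (x1 x2 x3 : C),
    x1 + bin s x2 x3 = bin s x2 x3 + x1;
  mci_axiom2 : forall s s' : bin_op S,
    exists (W : term S word_arg) (o i : word_arg -> bin_op S),
      forall (C : object E) (x1 x2 x3 : C),
        bin s' (bin s x1 x2) x3 = eval (word_arg_val o i x1 x2 x3) W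
}.

(** * Derived actions *)

Record action_maps (S : signature) (B A : algebra S) := ActionMaps {
  act_dot : B -> A -> A;
  act_bin : bin_op S -> B -> A -> A
}.

Record split_extension (S : signature) (E : identity S -> Prop)
    (A B : object E) := SplitExtension {
  ext_obj : object E;
  ext_inj : hom A ext_obj;
  ext_proj : hom ext_obj B;
  ext_sec : hom B ext_obj;
  ext_inj_injective : forall a a', ext_inj a = ext_inj a' -> a = a';
  ext_exact : forall e, ext_proj e = 0 <-> exists a, ext_inj a = e;
  ext_proj_surjective : forall b, exists e, ext_proj e = b;
  ext_secK : forall b, ext_proj (ext_sec b) = b
}.

Definition arises_from (S : signature) (E : identity S -> Prop)
    (A B : object E) (m : action_maps B A) (X : split_extension A B) : Prop :=
  (forall b a,
     ext_inj X (act_dot m b a) = ext_sec X b + ext_inj X a - ext_sec X b) /\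
  (forall s b a,
     ext_inj X (act_bin m s b a) = bin s (ext_sec X b) (ext_inj X a)).

Record derived_action (S : signature) (E : identity S -> Prop)
    (B A : object E) := DerivedAction {
  derived_maps :> action_maps B A;
  derived_ext : exists X : split_extension A B, arises_from derived_maps X
}.

(** * Crossed modules *)

Record precrossed_module (S : signature) (E : identity S -> Prop) :=
    PrecrossedModule {
  xm1 : object E;
  xm0 : object E;
  xm_act : derived_action xm0 xm1;
  xm_bd : hom xm1 xm0;
  xm_bd_dot : forall (c0 : xm0) (c1 : xm1),
    xm_bd (act_dot xm_act c0 c1) = c0 + xm_bd c1 - c0;
  xm_bd_bin : forall (s : bin_op S) (c0 : xm0) (c1 : xm1),
    xm_bd (act_bin xm_act s c0 c1) = bin s c0 (xm_bd c1)
}.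

Record crossed_module (S : signature) (E : identity S -> Prop) :=
    CrossedModule {
  xm_pre :> precrossed_module E;
  xm_peiffer_dot : forall c1 c1' : xm1 xm_pre,
    act_dot (xm_act xm_pre) (xm_bd xm_pre c1) c1' = c1 + c1' - c1;
  xm_peiffer_bin : forall (s : bin_op S) (c1 c1' : xm1 xm_pre),
    act_bin (xm_act xm_pre) s (xm_bd xm_pre c1) c1' = bin s c1 c1'
}.

Record xmod_hom (S : signature) (E : identity S -> Prop)
    (X Y : crossed_module E) := XModHom {
  xh1 : hom (xm1 X) (xm1 Y);
  xh0 : hom (xm0 X) (xm0 Y);
  xh_bd : forall c1, xh0 (xm_bd X c1) = xm_bd Y (xh1 c1);
  xh_dot : forall c0 c1,
    xh1 (act_dot (xm_act X) c0 c1) = act_dot (xm_act Y) (xh0 c0) (xh1 c1);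
  xh_bin : forall s c0 c1,
    xh1 (act_bin (xm_act X) s c0 c1) = act_bin (xm_act Y) s (xh0 c0) (xh1 c1)
}.

Definition xmod_id (S : signature) (E : identity S -> Prop)
    (X : crossed_module E) : xmod_hom X X :=
  @XModHom S E X X (hom_id (xm1 X)) (hom_id (xm0 X)) (fun _ => eq_refl)
    (fun _ _ => eq_refl) (fun _ _ _ => eq_refl).

Definition xmod_comp (S : signature) (E : identity S -> Prop)
    (X Y Z : crossed_module E) (g : xmod_hom Y Z) (f : xmod_hom X Y) :
  xmod_hom X Z.
Proof.
refine (@XModHom S E X Z (hom_comp (xh1 g) (xh1 f)) (hom_comp (xh0 g) (xh0 f))
  _ _ _); cbn.
- now intros c1; rewrite !xh_bd.
- now intros c0 c1; rewrite !xh_dot.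
- now intros s c0 c1; rewrite !xh_bin.
Defined.

(** * Cat1-objects *)

Record cat1_object (S : signature) (E : identity S -> Prop) := Cat1Object {
  cat1_obj : object E;
  cat1_w0 : hom cat1_obj cat1_obj;
  cat1_w1 : hom cat1_obj cat1_obj;
  cat1_w01 : forall x, cat1_w0 (cat1_w1 x) = cat1_w1 x;
  cat1_w10 : forall x, cat1_w1 (cat1_w0 x) = cat1_w0 x;
  cat1_ker_bin : forall (s : bin_op S) x y,
    cat1_w0 x = 0 -> cat1_w1 y = 0 -> bin s x y = 0;
  cat1_ker_comm : forall x y,
    cat1_w0 x = 0 -> cat1_w1 y = 0 -> x + y - x - y = 0
}.

Record cat1_hom (S : signature) (E : identity S -> Prop)
    (X Y : cat1_object E) := Cat1Hom {
  c1h :> hom (cat1_obj X) (cat1_obj Y);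
  c1h_w0 : forall x, c1h (cat1_w0 X x) = cat1_w0 Y (c1h x);
  c1h_w1 : forall x, c1h (cat1_w1 X x) = cat1_w1 Y (c1h x)
}.

Definition cat1_id (S : signature) (E : identity S -> Prop)
    (X : cat1_object E) : cat1_hom X X :=
  @Cat1Hom S E X X (hom_id (cat1_obj X)) (fun _ => eq_refl) (fun _ => eq_refl).

Definition cat1_comp (S : signature) (E : identity S -> Prop)
    (X Y Z : cat1_object E) (g : cat1_hom Y Z) (f : cat1_hom X Y) :
  cat1_hom X Z.
Proof.
refine (@Cat1Hom S E X Z (hom_comp g f) _ _); cbn.
- now intros x; rewrite !c1h_w0.
- now intros x; rewrite !c1h_w1.
Defined.

(** * The categories XMod(C) and Cat1(C) *)

Lemma hom_eq (S : signature) (A B : algebra S) (f g : hom A B) :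
  hom_fun f = hom_fun g -> f = g.
Proof.
destruct f as [f ? ? ? ? ?], g as [g ? ? ? ? ?]; cbn; intros e; subst g.
f_equal; apply proof_irrelevance.
Qed.

Lemma xmod_hom_eq (S : signature) (E : identity S -> Prop)
    (X Y : crossed_module E) (f g : xmod_hom X Y) :
  hom_fun (xh1 f) = hom_fun (xh1 g) -> hom_fun (xh0 f) = hom_fun (xh0 g) ->
  f = g.
Proof.
destruct f as [f1 f0 ? ? ?], g as [g1 g0 ? ? ?]; cbn; intros e1 e0.
apply hom_eq in e1; apply hom_eq in e0; subst g1 g0.
f_equal; apply proof_irrelevance.
Qed.

Lemma cat1_hom_eq (S : signature) (E : identity S -> Prop)
    (X Y : cat1_object E) (f g : cat1_hom X Y) :
  hom_fun f = hom_fun g -> f = g.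
Proof.
destruct f as [f ? ?], g as [g ? ?]; cbn; intros e.
apply hom_eq in e; subst g.
f_equal; apply proof_irrelevance.
Qed.

Definition XMod (S : signature) (E : identity S -> Prop) : category.
Proof.
refine (@Category (crossed_module E) (@xmod_hom S E) (@xmod_id S E)
  (@xmod_comp S E) _ _ _); intros; now apply xmod_hom_eq.
Defined.

Definition Cat1 (S : signature) (E : identity S -> Prop) : category.
Proof.
refine (@Category (cat1_object E) (@cat1_hom S E) (@cat1_id S E)
  (@cat1_comp S E) _ _ _); intros; now apply cat1_hom_eq.
Defined.

(* Main.v *)
(** A crossed module [(C1, C0, d)] is sent to the semidirect product of [C0]
    acting on [C1], with [w0 (a, b) = (0, b)] and [w1 (a, b) = (0, d a + b)];
    a cat1-object [(C, w0, w1)] is sent to the restriction of [w1] to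
    [ker w0 -> im w0], where [im w0] acts inside [C].  The split extension
    behind a derived action is only known to exist, so the semidirect product is
    given by formulas in the action maps; the map [(a, b) |-> i a + s b] into the
    middle object of any extension inducing the action is an injective
    homomorphism, and this is what transfers the identities. *)

From Stdlib Require Import Setoid ProofIrrelevance FunctionalExtensionality.
Require Import Defs.

Set Implicit Arguments.
Unset Strict Implicit.
Unset Printing Implicit Defensive.

Local Open Scope alg_scope.

Lemma sig_val_inj (T : Type) (P : T -> Prop) (u v : sig P) :
  proj1_sig u = proj1_sig v -> u = v.
Proof.
destruct u as [x p], v as [y q]; cbn; intros e; subst y.
f_equal; apply proof_irrelevance.
Qed.

(** * Homomorphisms, transfer of identities along injections, subalgebras *)

Section Algebras.
Context (S : signature).

Lemma hom_eval (A B : algebra S) (f : hom A B) (V : Type) (v : V -> A)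
    (t : term S V) :
  f (eval v t) = eval (fun n => f (v n)) t.
Proof.
induction t as [n| |t IH|t IHt u IHu|w t IH|s t IHt u IHu]; cbn.
- reflexivity.
- apply hom_zero.
- now rewrite hom_neg, IH.
- now rewrite hom_add, IHt, IHu.
- now rewrite hom_un, IH.
- now rewrite hom_bin, IHt, IHu.
Qed.

Lemma satisfies_inj (A B : algebra S) (f : hom A B) (e : identity S) :
  (forall x y, f x = f y -> x = y) -> satisfies B e -> satisfies A e.
Proof.
intros f_inj Be v; apply f_inj; rewrite !hom_eval; apply Be.
Qed.

(** Each equation required of [h] may be checked after applying the injective [f], where it becomes
    an equation for [g]. With [f] the inclusion of a subalgebra, this produces all the maps into
    kernels and images below. *)
Definition hom_lift (A B C : algebra S) (f : hom B C) (g : hom A C)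
    (h : A -> B) (f_inj : forall x y, f x = f y -> x = y)
    (fh : forall x, f (h x) = g x) : hom A B.
Proof.
refine (@MkHom S A B h _ _ _ _ _); intros; apply f_inj; rewrite fh.
- now rewrite !hom_zero.
- now rewrite !hom_neg, fh.
- now rewrite !hom_add, !fh.
- now rewrite !hom_un, fh.
- now rewrite !hom_bin, !fh.
Defined.

Definition hom_inverse (A B : algebra S) (f : hom A B) (g : B -> A)
    (fK : forall x, g (f x) = x) (gK : forall y, f (g y) = y) : hom B A.
Proof.
refine (@hom_lift B A B f (hom_id B) g _ gK).
intros x y e; now rewrite <- (fK x), e, fK.
Defined.

Record closed (A : algebra S) (P : A -> Prop) : Prop := Closed {
  closed_zero : P 0;
  closed_neg : forall x, P x -> P (- x);
  closed_add : forall x y, P x -> P y -> P (x + y);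
  closed_un : forall w x, P x -> P (un w x);
  closed_bin : forall s x y, P x -> P y -> P (bin s x y)
}.

Definition sub_algebra (A : algebra S) (P : A -> Prop) (cP : closed P) :
    algebra S :=
  {| carrier := {x : A | P x};
     zero := exist P 0 (closed_zero cP);
     neg := fun u => exist P _ (closed_neg cP (proj2_sig u));
     add := fun u v => exist P _ (closed_add cP (proj2_sig u) (proj2_sig v));
     un := fun w u => exist P _ (closed_un cP w (proj2_sig u));
     bin := fun s u v =>
       exist P _ (closed_bin cP s (proj2_sig u) (proj2_sig v)) |}.

Definition sub_val (A : algebra S) (P : A -> Prop) (cP : closed P) :
    hom (sub_algebra cP) A :=
  @MkHom S (sub_algebra cP) A (@proj1_sig A P) eq_refl (fun _ => eq_refl)
    (fun _ _ => eq_refl) (fun _ _ => eq_refl) (fun _ _ _ => eq_refl).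

Definition sub_object (E : identity S -> Prop) (A : object E) (P : A -> Prop)
    (cP : closed P) : object E.
Proof.
refine (@Object S E (sub_algebra cP) _); intros e Ee.
apply (satisfies_inj (f := sub_val cP)).
- exact (@sig_val_inj A P).
- now apply object_sat.
Defined.

Lemma fixed_closed (A : algebra S) (f : hom A A) : closed (fun x => f x = x).
Proof.
split.
- apply hom_zero.
- now intros x fx; rewrite hom_neg, fx.
- now intros x y fx fy; rewrite hom_add, fx, fy.
- now intros w x fx; rewrite hom_un, fx.
- now intros s x y fx fy; rewrite hom_bin, fx, fy.
Qed.

End Algebras.

Section ModifiedCategory.
Context (S : signature) (E : identity S -> Prop).
Context (hC : modified_category_of_interest E).

(** * Group arithmetic and distributivity inside an object *)

Section Laws.
Context (A : object E).
Implicit Types x y z : A.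

(** The identities to be instantiated use only the variables 0, 1 and 2, so the value at later
    indices is arbitrary. *)
Let valuation x y z (n : nat) : A :=
  match n with 0%nat => x | 1%nat => y | _ => z end.

Lemma addA x y z : x + y + z = x + (y + z).
Proof. symmetry; exact (object_sat (mci_addA hC) (valuation x y z)). Qed.

Lemma add0l x : 0 + x = x.
Proof. exact (object_sat (mci_add0l hC) (valuation x x x)). Qed.

Lemma add0r x : x + 0 = x.
Proof. exact (object_sat (mci_add0r hC) (valuation x x x)). Qed.

Lemma addNl x : - x + x = 0.
Proof. exact (object_sat (mci_addNl hC) (valuation x x x)). Qed.

Lemma addNr x : x - x = 0.
Proof. exact (object_sat (mci_addNr hC) (valuation x x x)). Qed.

Lemma bin_addr s x y z : bin s x (y + z) = bin s x y + bin s x z.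
Proof. exact (object_sat (mci_distr hC s) (valuation x y z)). Qed.

Lemma un_add w x y : un w (x + y) = un w x + un w y.
Proof. exact (object_sat (mci_un_add hC w) (valuation x y y)). Qed.

Lemma addKl x y : - x + (x + y) = y.
Proof. now rewrite <- addA, addNl, add0l. Qed.

Lemma addNKl x y : x + (- x + y) = y.
Proof. now rewrite <- addA, addNr, add0l. Qed.

Lemma add_cancell x y z : x + y = x + z -> y = z.
Proof. intros e; now rewrite <- (addKl x y), e, addKl. Qed.

Lemma add_cancelr x y z : y + x = z + x -> y = z.
Proof.
intros e; now rewrite <- (add0r y), <- (addNr x), <- addA, e, addA, addNr, add0r.
Qed.

Lemma neg_unique x y : x + y = 0 -> - x = y.
Proof. intros e; now rewrite <- (addKl x y), e, add0r. Qed.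

Lemma negK x : - - x = x.
Proof. apply neg_unique, addNl. Qed.

Lemma neg_zero : - (0 : A) = 0.
Proof. apply neg_unique, add0l. Qed.

Lemma neg_add x y : - (x + y) = - y - x.
Proof. apply neg_unique; now rewrite addA, addNKl, addNr. Qed.

Lemma sub_eq0 x y : x - y = 0 -> x = y.
Proof. intros e; apply (@add_cancelr (- y)); now rewrite addNr. Qed.

Lemma commutator_eq0 x y : x + y - x - y = 0 -> x + y = y + x.
Proof.
intros e; apply sub_eq0 in e; rewrite <- e at 2.
now rewrite !addA, addNl, add0r.
Qed.

(** This is distributivity on the other side for the opposite operation. *)
Lemma bin_addl s x y z : bin s (x + y) z = bin s x z + bin s y z.
Proof. now rewrite <- !(mci_op hC s), bin_addr. Qed.

Lemma bin_zeror s x : bin s x 0 = 0.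
Proof.
apply (@add_cancell (bin s x 0)); now rewrite <- bin_addr, !add0r.
Qed.

Lemma bin_zerol s x : bin s 0 x = 0.
Proof. now rewrite <- (mci_op hC), bin_zeror. Qed.

Lemma un_zero w : un w (0 : A) = 0.
Proof.
apply (@add_cancell (un w 0)); now rewrite <- un_add, !add0r.
Qed.

Lemma bin_negr s x y : bin s x (- y) = - bin s x y.
Proof.
symmetry; apply neg_unique; now rewrite <- bin_addr, addNr, bin_zeror.
Qed.

End Laws.

Hint Rewrite addA add0l add0r addNl addNr addKl addNKl negK neg_zero neg_add
  : group.
Hint Rewrite bin_zeror bin_zerol un_zero : group.
Hint Rewrite hom_zero hom_neg hom_add hom_un hom_bin : morphism.

(** * The semidirect product of a derived action *)

Section Semidirect.
Context (B A : object E) (m : derived_action B A).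

(** The formulas come from computing with [a + b] in an extension: [-(a + b)] is [(-b).(-a) + (-b)],
    and a product of sums expands into four terms. Actions are written with [B] on the left, so the
    term of [a] times [b'] is expressed through [op s]. *)
Definition semidirect_alg : algebra S :=
  {| carrier := (A * B)%type;
     zero := (0, 0);
     neg := fun u => (act_dot m (- snd u) (- fst u), - snd u);
     add := fun u v => (fst u + act_dot m (snd u) (fst v), snd u + snd v);
     un := fun w u => (un w (fst u), un w (snd u));
     bin := fun s u v =>
       (bin s (fst u) (fst v) + act_bin m s (snd u) (fst v)
          + act_bin m (op s) (snd v) (fst u),
        bin s (snd u) (snd v)) |}.

Section Extension.
Context (X : split_extension A B) (mX : arises_from m X).

Definition semidirect_to_ext : hom semidirect_alg (ext_obj X).
Proof.
pose proof (proj1 mX) as dotE; pose proof (proj2 mX) as binE.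
refine (@MkHom S semidirect_alg (ext_obj X)
  (fun u => ext_inj X (fst u) + ext_sec X (snd u)) _ _ _ _ _); cbn.
- now rewrite !hom_zero, add0l.
- intros u; rewrite dotE; autorewrite with morphism group; reflexivity.
- intros u v; rewrite hom_add, dotE; autorewrite with morphism group.
  reflexivity.
- intros w u; now rewrite un_add, !hom_un.
- intros s u v; rewrite !hom_add, !binE, !hom_bin, (mci_op hC).
  now rewrite bin_addr, !bin_addl, !addA.
Defined.

Lemma ext_proj_inj (a : A) : ext_proj X (ext_inj X a) = 0.
Proof. apply ext_exact; now exists a. Qed.

(** The projection of the extension recovers the [B]-component; cancelling it leaves the injection
    of [A]. *)
Lemma semidirect_to_ext_inj (u v : semidirect_alg) :
  semidirect_to_ext u = semidirect_to_ext v -> u = v.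
Proof.
destruct u as [a b], v as [a' b']; cbn; intros e.
assert (eb : b = b').
{ apply (f_equal (ext_proj X)) in e.
  now rewrite !hom_add, !ext_proj_inj, !add0l, !ext_secK in e. }
subst b'; apply add_cancelr in e; apply ext_inj_injective in e.
now subst a'.
Qed.

End Extension.

Definition semidirect : object E.
Proof.
refine (@Object S E semidirect_alg _); intros e Ee.
destruct (derived_ext m) as [X mX].
apply (satisfies_inj (f := semidirect_to_ext mX)).
- apply semidirect_to_ext_inj.
- now apply object_sat.
Defined.

(** Laws of a derived action are verified in an extension inducing it, where the action is
    conjugation and multiplication by elements of the section. *)
Lemma act_dot_zerol (a : A) : act_dot m 0 a = a.
Proof.
destruct (derived_ext m) as [X [dotE binE]]; apply (@ext_inj_injective _ _ _ _ X).
rewrite dotE; autorewrite with morphism group; reflexivity.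
Qed.

Lemma act_dot_zeror (b : B) : act_dot m b 0 = 0.
Proof.
destruct (derived_ext m) as [X [dotE binE]]; apply (@ext_inj_injective _ _ _ _ X).
rewrite dotE; autorewrite with morphism group; reflexivity.
Qed.

Lemma act_bin_zerol s (a : A) : act_bin m s 0 a = 0.
Proof.
destruct (derived_ext m) as [X [dotE binE]]; apply (@ext_inj_injective _ _ _ _ X).
rewrite binE; autorewrite with morphism group; reflexivity.
Qed.

Lemma act_bin_zeror s (b : B) : act_bin m s b 0 = 0.
Proof.
destruct (derived_ext m) as [X [dotE binE]]; apply (@ext_inj_injective _ _ _ _ X).
rewrite binE; autorewrite with morphism group; reflexivity.
Qed.

Hint Rewrite act_dot_zerol act_dot_zeror act_bin_zerol act_bin_zeror : group.

Definition semidirect_inl : hom A semidirect.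
Proof.
refine (@MkHom S A semidirect (fun a => (a, 0)) _ _ _ _ _); intros; cbn;
  autorewrite with group; reflexivity.
Defined.

Definition semidirect_inr : hom B semidirect.
Proof.
refine (@MkHom S B semidirect (fun b => (0, b)) _ _ _ _ _); intros; cbn;
  autorewrite with group; reflexivity.
Defined.

Definition semidirect_snd : hom semidirect B :=
  @MkHom S semidirect B snd eq_refl (fun _ => eq_refl) (fun _ _ => eq_refl)
    (fun _ _ => eq_refl) (fun _ _ _ => eq_refl).

(** Together with [semidirect_bin], this shows that the action is induced inside the semidirect
    product itself; the two facts later give equivariance of the unit. *)
Lemma semidirect_dot (b : B) (a : A) :
  semidirect_inl (act_dot m b a)
  = semidirect_inr b + semidirect_inl a - semidirect_inr b.
Proof. cbn; autorewrite with group; reflexivity. Qed.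

Lemma semidirect_bin s (b : B) (a : A) :
  semidirect_inl (act_bin m s b a) = bin s (semidirect_inr b) (semidirect_inl a).
Proof. cbn; autorewrite with group; reflexivity. Qed.

End Semidirect.

Hint Rewrite act_dot_zerol act_dot_zeror act_bin_zerol act_bin_zeror : group.

(** * From crossed modules to cat1-objects *)

Section CrossedToCat1.
Context (X : crossed_module E).

Definition xmod_source : object E := semidirect (xm_act X).

(** The precrossed conditions are what make this map compatible with sums and products. *)
Definition xmod_target : hom xmod_source (xm0 X).
Proof.
refine (@MkHom S xmod_source (xm0 X) (fun u => xm_bd X (fst u) + snd u)
  _ _ _ _ _); cbn.
- now rewrite hom_zero, add0l.
- intros u; rewrite xm_bd_dot; autorewrite with morphism group; reflexivity.
- intros u v; rewrite hom_add, xm_bd_dot; autorewrite with group; reflexivity.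
- intros w u; now rewrite un_add, hom_un.
- intros s u v; rewrite !hom_add, !xm_bd_bin, hom_bin, (mci_op hC).
  now rewrite bin_addr, !bin_addl, !addA.
Defined.

Definition cat1_of_xmod : cat1_object E.
Proof.
refine (@Cat1Object S E xmod_source
  (hom_comp (semidirect_inr (xm_act X)) (semidirect_snd (xm_act X)))
  (hom_comp (semidirect_inr (xm_act X)) xmod_target) _ _ _ _); cbn.
- reflexivity.
- intros u; now rewrite hom_zero, add0l.
(* Here [b = 0] and [b' = - xm_bd X a'], so by the Peiffer identity [b'] acts as [- a'] and the
   product terms cancel. The commutator is treated in the same way. *)
- intros s [a b] [a' b'] e0 e1; cbn in *.
  injection e0 as e0; injection e1 as e1; subst b.
  apply neg_unique in e1; subst b'.
  rewrite <- (hom_neg (xm_bd X)), xm_peiffer_bin, (mci_op hC), bin_negr.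
  autorewrite with group; reflexivity.
- intros [a b] [a' b'] e0 e1; cbn in *.
  injection e0 as e0; injection e1 as e1; subst b.
  apply neg_unique in e1; subst b'.
  autorewrite with group.
  rewrite <- (hom_neg (xm_bd X)), !xm_peiffer_dot.
  autorewrite with group; reflexivity.
Defined.

End CrossedToCat1.

Definition cat1_of_xmod_hom (X Y : crossed_module E) (f : xmod_hom X Y) :
  cat1_hom (cat1_of_xmod X) (cat1_of_xmod Y).
Proof.
unshelve refine (@Cat1Hom S E (cat1_of_xmod X) (cat1_of_xmod Y)
  (@MkHom S (xmod_source X) (xmod_source Y)
    (fun u => (xh1 f (fst u), xh0 f (snd u))) _ _ _ _ _) _ _); cbn.
- now rewrite !hom_zero.
- intros u; now rewrite xh_dot, !hom_neg.
- intros u v; now rewrite !hom_add, xh_dot.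
- intros w u; now rewrite !hom_un.
- intros s u v; now rewrite !hom_add, !xh_bin, !hom_bin.
- intros u; now rewrite hom_zero.
- intros u; now rewrite hom_zero, hom_add, xh_bd.
Defined.

Definition cat1_of_xmod_functor : functor (XMod E) (Cat1 E).
Proof.
refine (@Functor (XMod E) (Cat1 E) cat1_of_xmod cat1_of_xmod_hom _ _).
- intros X; apply cat1_hom_eq, functional_extensionality; now intros [a b].
- intros X Y Z g f; apply cat1_hom_eq; reflexivity.
Defined.

(** * From cat1-objects to crossed modules *)

Section Cat1ToCrossed.
Context (Y : cat1_object E).
Local Notation C := (cat1_obj Y).

(** [w0 w0 = w0 w1 w0 = w1 w0 = w0]. *)
Lemma cat1_w0_idem (x : C) : cat1_w0 Y (cat1_w0 Y x) = cat1_w0 Y x.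
Proof. now rewrite <- (cat1_w10 (c := Y) x), cat1_w01. Qed.

(** Since [w1] is the identity on [im w0], its restriction to [ker w0] respects the action of
    [im w0]. *)
Lemma cat1_w1_fixed (x : C) : cat1_w0 Y x = x -> cat1_w1 Y x = x.
Proof. intros e; now rewrite <- e, cat1_w10. Qed.

Lemma kernel_closed : closed (fun x : C => cat1_w0 Y x = 0).
Proof.
split.
- apply hom_zero.
- intros x e; now rewrite hom_neg, e, neg_zero.
- intros x y e e'; now rewrite hom_add, e, e', add0l.
- intros w x e; now rewrite hom_un, e, un_zero.
- intros s x y e e'; now rewrite hom_bin, e, bin_zerol.
Qed.

Definition cat1_kernel : object E := sub_object kernel_closed.

(** As [w0] is idempotent, its image is its set of fixed points; in this form membership is an
    equation. *)
Definition cat1_image : object E := sub_object (fixed_closed (cat1_w0 Y)).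

Definition cat1_act_maps : action_maps cat1_image cat1_kernel.
Proof.
refine (@ActionMaps S cat1_image cat1_kernel
  (fun b a => exist _ (proj1_sig b + proj1_sig a - proj1_sig b) _)
  (fun s b a => exist _ (bin s (proj1_sig b) (proj1_sig a)) _)).
- abstract (now rewrite !hom_add, (proj2_sig a), hom_neg, add0r, addNr).
- abstract (now rewrite hom_bin, (proj2_sig a), bin_zeror).
Defined.

Definition cat1_retract : hom C cat1_image :=
  @hom_lift S C cat1_image C (sub_val _) (cat1_w0 Y)
    (fun x => exist _ (cat1_w0 Y x) (cat1_w0_idem x)) (@sig_val_inj _ _)
    (fun _ => eq_refl).

(** The middle object is [C], projected by [w0] and split by the inclusion of [im w0]. *)
Definition cat1_extension : split_extension cat1_kernel cat1_image.
Proof.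
refine (@SplitExtension S E cat1_kernel cat1_image C (sub_val _) cat1_retract
  (sub_val _) (@sig_val_inj _ _) _ _ _).
- intros x; split.
  + intros e; apply (f_equal (@proj1_sig _ _)) in e; cbn in e.
    now exists (exist _ x e).
  + intros [[a e] <-]; now apply sig_val_inj.
- intros b; exists (proj1_sig b); apply sig_val_inj, (proj2_sig b).
- intros b; apply sig_val_inj, (proj2_sig b).
Defined.

Lemma cat1_act_arises : arises_from cat1_act_maps cat1_extension.
Proof. split; reflexivity. Qed.

Definition cat1_act : derived_action cat1_image cat1_kernel :=
  @DerivedAction S E cat1_image cat1_kernel cat1_act_maps
    (ex_intro _ _ cat1_act_arises).

Definition cat1_bd : hom cat1_kernel cat1_image :=
  @hom_lift S cat1_kernel cat1_image C (sub_val _)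
    (hom_comp (cat1_w1 Y) (sub_val _))
    (fun a => exist _ (cat1_w1 Y (proj1_sig a)) (cat1_w01 (c := Y) _))
    (@sig_val_inj _ _) (fun _ => eq_refl).

Definition precrossed_of_cat1 : precrossed_module E.
Proof.
refine (@PrecrossedModule S E cat1_kernel cat1_image cat1_act cat1_bd _ _);
  intros; apply sig_val_inj; cbn.
- now rewrite !hom_add, hom_neg, (cat1_w1_fixed (proj2_sig c0)).
- now rewrite hom_bin, (cat1_w1_fixed (proj2_sig c0)).
Defined.

Lemma cat1_w1_idem (x : C) : cat1_w1 Y (cat1_w1 Y x) = cat1_w1 Y x.
Proof. apply cat1_w1_fixed, cat1_w01. Qed.

(** Both Peiffer identities hold because [- a + w1 a] lies in [ker w1], so it
    annihilates and commutes with [ker w0]. *)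
Definition xmod_of_cat1 : crossed_module E.
Proof.
assert (ker1 : forall a : C, cat1_w1 Y (- a + cat1_w1 Y a) = 0).
{ intros a; now rewrite hom_add, hom_neg, cat1_w1_idem, addNl. }
refine (@CrossedModule S E precrossed_of_cat1 _ _); cbn.
- intros [a ea] [a' ea']; apply sig_val_inj; cbn.
  pose proof (commutator_eq0 (cat1_ker_comm ea' (ker1 a))) as comm.
  apply (@add_cancelr C (cat1_w1 Y a)), (@add_cancell C (- a)).
  autorewrite with group in comm |- *; now symmetry.
- intros s [a ea] [a' ea']; apply sig_val_inj; cbn.
  (* Passing to [op s] puts [a'], which lies in [ker w0], on the left as [cat1_ker_bin] requires. *)
  rewrite <- !(mci_op hC s).
  apply (@add_cancell C (- bin (op s) a' a)).
  rewrite <- bin_negr, <- !bin_addr, addNl, bin_zeror.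
  exact (cat1_ker_bin (op s) ea' (ker1 a)).
Defined.

End Cat1ToCrossed.

Section Cat1Hom.
Context (X Y : cat1_object E) (f : cat1_hom X Y).

Definition cat1_hom_kernel : hom (cat1_kernel X) (cat1_kernel Y).
Proof.
refine (@hom_lift S (cat1_kernel X) (cat1_kernel Y) (cat1_obj Y) (sub_val _)
  (hom_comp f (sub_val _)) (fun a => exist _ (f (proj1_sig a)) _)
  (@sig_val_inj _ _) (fun _ => eq_refl)).
abstract (now rewrite <- c1h_w0, (proj2_sig a), hom_zero).
Defined.

Definition cat1_hom_image : hom (cat1_image X) (cat1_image Y).
Proof.
refine (@hom_lift S (cat1_image X) (cat1_image Y) (cat1_obj Y) (sub_val _)
  (hom_comp f (sub_val _)) (fun b => exist _ (f (proj1_sig b)) _)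
  (@sig_val_inj _ _) (fun _ => eq_refl)).
abstract (now rewrite <- c1h_w0, (proj2_sig b)).
Defined.

Definition xmod_of_cat1_hom : xmod_hom (xmod_of_cat1 X) (xmod_of_cat1 Y).
Proof.
refine (@XModHom S E (xmod_of_cat1 X) (xmod_of_cat1 Y)
  cat1_hom_kernel cat1_hom_image _ _ _); intros; apply sig_val_inj; cbn.
- apply c1h_w1.
- now rewrite !hom_add, hom_neg.
- now rewrite hom_bin.
Defined.

End Cat1Hom.

Definition xmod_of_cat1_functor : functor (Cat1 E) (XMod E).
Proof.
refine (@Functor (Cat1 E) (XMod E) xmod_of_cat1 xmod_of_cat1_hom _ _);
  intros; apply xmod_hom_eq; apply functional_extensionality; intros u;
  now apply sig_val_inj.
Defined.

(** * The unit isomorphism *)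

Section Unit.
Context (X : crossed_module E).
Local Notation X' := (xmod_of_cat1 (cat1_of_xmod X)).

(** In the semidirect product, [ker w0] consists of the pairs [(a, 0)] and [im w0] of the pairs
    [(0, b)]. The two inclusions thus give the components of the unit, and membership holds by
    computation. *)
Definition unit1 : hom (xm1 X) (xm1 X') :=
  @hom_lift S (xm1 X) (xm1 X') (xmod_source X) (sub_val _)
    (semidirect_inl (xm_act X))
    (fun a => exist _ (semidirect_inl (xm_act X) a) eq_refl)
    (@sig_val_inj _ _) (fun _ => eq_refl).

Definition unit0 : hom (xm0 X) (xm0 X') :=
  @hom_lift S (xm0 X) (xm0 X') (xmod_source X) (sub_val _)
    (semidirect_inr (xm_act X))
    (fun b => exist _ (semidirect_inr (xm_act X) b) eq_refl)
    (@sig_val_inj _ _) (fun _ => eq_refl).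

Definition unit_to : xmod_hom X X'.
Proof.
refine (@XModHom S E X X' unit1 unit0 _ _ _); intros; apply sig_val_inj.
- cbn; now rewrite add0r.
- apply semidirect_dot.
- apply semidirect_bin.
Defined.

Definition unit1_inv (u : xm1 X') : xm1 X := fst (proj1_sig u).
Definition unit0_inv (u : xm0 X') : xm0 X := snd (proj1_sig u).

Lemma unit1_invK u : unit1 (unit1_inv u) = u.
Proof.
destruct u as [[a b] e]; apply sig_val_inj; cbn in *.
now injection e as e; subst b.
Qed.

Lemma unit0_invK u : unit0 (unit0_inv u) = u.
Proof.
destruct u as [[a b] e]; apply sig_val_inj; cbn in *.
now injection e as e; subst a.
Qed.

End Unit.

(** Writing each argument as an image under [f] turns compatibility of the inverse into that of [f],
    so set-theoretic inverses suffice to build the isomorphisms. *)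
Definition xmod_hom_inverse (X Y : crossed_module E) (f : xmod_hom X Y)
    (g1 : xm1 Y -> xm1 X) (g0 : xm0 Y -> xm0 X)
    (f1K : forall x, g1 (xh1 f x) = x) (g1K : forall y, xh1 f (g1 y) = y)
    (f0K : forall x, g0 (xh0 f x) = x) (g0K : forall y, xh0 f (g0 y) = y) :
  xmod_hom Y X.
Proof.
refine (@XModHom S E Y X (hom_inverse f1K g1K) (hom_inverse f0K g0K) _ _ _); cbn.
- intros c; now rewrite <- (g1K c) at 1; rewrite <- xh_bd, f0K.
- intros b a; rewrite <- (g1K a) at 1; rewrite <- (g0K b) at 1.
  now rewrite <- xh_dot, f1K.
- intros s b a; rewrite <- (g1K a) at 1; rewrite <- (g0K b) at 1.
  now rewrite <- xh_bin, f1K.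
Defined.

Definition cat1_hom_inverse (X Y : cat1_object E) (f : cat1_hom X Y)
    (g : cat1_obj Y -> cat1_obj X)
    (fK : forall x, g (f x) = x) (gK : forall y, f (g y) = y) : cat1_hom Y X.
Proof.
refine (@Cat1Hom S E Y X (hom_inverse fK gK) _ _); cbn; intros y.
- now rewrite <- (gK y) at 1; rewrite <- c1h_w0, fK.
- now rewrite <- (gK y) at 1; rewrite <- c1h_w1, fK.
Defined.

Definition unit_iso :
  nat_iso (functor_id (XMod E))
    (functor_comp xmod_of_cat1_functor cat1_of_xmod_functor).
Proof.
refine (@NatIso (XMod E) (XMod E) (functor_id (XMod E))
  (functor_comp xmod_of_cat1_functor cat1_of_xmod_functor) unit_to
  (fun X => @xmod_hom_inverse _ _ (unit_to X) (@unit1_inv X) (@unit0_inv X)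
    (fun _ => eq_refl) (@unit1_invK X) (fun _ => eq_refl) (@unit0_invK X))
  _ _ _); intros; apply xmod_hom_eq; apply functional_extensionality; intros u.
- reflexivity.
- reflexivity.
- apply unit1_invK.
- apply unit0_invK.
(* Naturality compares [(xh1 f u, 0)] with [(xh1 f u, xh0 f 0)], then likewise in the other
   component. *)
- apply sig_val_inj; cbn; now rewrite hom_zero.
- apply sig_val_inj; cbn; now rewrite hom_zero.
Defined.

(** * The counit isomorphism *)

Section Counit.
Context (Y : cat1_object E).
Local Notation Y' := (cat1_of_xmod (xmod_of_cat1 Y)).

(** For [cat1_extension] the comparison map is [(a, b) |-> a + b] into the original object. *)
Definition counit_to : cat1_hom Y' Y.
Proof.
refine (@Cat1Hom S E Y' Y
  (semidirect_to_ext (m := cat1_act Y) (cat1_act_arises Y)) _ _);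
  intros [[a ea] [b eb]]; cbn; rewrite add0l, hom_add.
- now rewrite ea, eb, add0l.
- now rewrite (cat1_w1_fixed eb).
Defined.

(** This is the decomposition [y = (y - w0 y) + w0 y] into parts in [ker w0] and [im w0]. *)
Definition counit_inv (y : cat1_obj Y) : cat1_obj Y'.
Proof.
refine (exist _ (y - cat1_w0 Y y) _, cat1_retract Y y).
abstract (now rewrite hom_add, hom_neg, cat1_w0_idem, addNr).
Defined.

Lemma counit_invK y : counit_to (counit_inv y) = y.
Proof. cbn; now rewrite addA, addNl, add0r. Qed.

(** A right inverse of an injective map is also a left inverse. *)
Lemma counit_toK u : counit_inv (counit_to u) = u.
Proof.
apply (semidirect_to_ext_inj (m := cat1_act Y) (mX := cat1_act_arises Y)).
exact (counit_invK (counit_to u)).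
Qed.

End Counit.

Definition counit_iso :
  nat_iso (functor_comp cat1_of_xmod_functor xmod_of_cat1_functor)
    (functor_id (Cat1 E)).
Proof.
refine (@NatIso (Cat1 E) (Cat1 E)
  (functor_comp cat1_of_xmod_functor xmod_of_cat1_functor) (functor_id (Cat1 E))
  counit_to
  (fun Y => @cat1_hom_inverse _ _ (counit_to Y) (@counit_inv Y)
    (@counit_toK Y) (@counit_invK Y))
  _ _ _); intros; apply cat1_hom_eq; apply functional_extensionality; intros u.
- apply counit_toK.
- apply counit_invK.
(* Naturality at [(a, b)] reads [f a + f b = f (a + b)]. *)
- symmetry; apply hom_add.
Defined.

End ModifiedCategory.

Theorem proposition15 (S : signature) (E : identity S -> Prop)
    (hC : modified_category_of_interest E) :
  inhabited (equivalence (XMod E) (Cat1 E)).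
Proof. exact (inhabits (Equivalence (unit_iso hC) (counit_iso hC))). Qed.
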